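(* Let $\epsilon_0\in\{1,-1\}$. If $n+s$ is even with $0\le s\le n-4$ and $n+s\ge6$, there exists a ternary pure quantum code with parameters $[[\frac{3^{n-1}+2\epsilon_0\cdot3^{\frac{n+s}{2}-1}-1}{2},\,\frac{3^{n-1}+2\epsilon_0\cdot3^{\frac{n+s}{2}-1}-1}{2}-2n+2,\,3]]_3$, which is at least almost optimal according to the quantum Hamming bound. If $n+s$ is odd with $0\le s\le n-3$ and $n+s\ge5$, there exists a ternary pure quantum code with parameters $[[\frac{3^{n-1}-1}{2},\,\frac{3^{n-1}-1}{2}-2n+2,\,3]]_3$, which is at least almost optimal according to the quantum Hamming bound.
   Context: $n,s$ are non-negative integers. A $p$-ary $[[N,K,d]]_p$ quantum code is a $p^K$-dimensional subspace $Q$ of $\mathbb{C}^{p^N}$ with minimum distance $d$; it is pure if $\langle v_1|E|v_2\rangle=0$ for all $v_1,v_2\in Q$ and every error operator $E$ of quantum weight between $1$ and $d-1$. The quantum Hamming bound for a pure $[[N,K,d]]_p$ code is $p^{N-K}\ge\sum_{j=0}^{\lfloor(d-1)/2\rfloor}\binom{N}{j}(p^2-1)^j$. An $[[N,K,d]]_p$ code is optimal if no $[[N,K,d+1]]_p$ code exists, almost optimal if an optimal $[[N,K,d+1]]_p$ code exists; ''at least almost optimal according to the quantum Hamming bound'' means the quantum Hamming bound certifies it is optimal or almost optimal for its length and dimension. *)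

(* Defs.v *)
From HB Require Import structures.
From mathcomp Require Import all_boot all_order all_algebra all_field.
Set Implicit Arguments. Unset Strict Implicit. Unset Printing Implicit Defensive.
Import Order.TTheory GRing.Theory Num.Theory.
Local Open Scope ring_scope.

(* computational basis labels of (C^p)^{tensor N}: vectors x in (Z_p)^N *)
Definition basis_lbl (p N : nat) := {ffun 'I_N -> 'Z_p}.

Definition qstate (p N : nat) := {ffun basis_lbl p N -> algC^o}.

(* a fixed primitive p-th root of unity (p > 0 assumed; default p := 1) *)
Definition omega (p : nat) : algC :=
  match ltnP 0 p with
  | LtnNotGeq h => sval (C_prim_root_exists h)
  | _ => 1
  end.

Definition zdot (p N : nat) (b x : basis_lbl p N) : 'Z_p := \sum_i (b i * x i).

(* generalized Pauli error operator E = X(a) Z(b):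
   Z(b)|y> = omega^(b.y) |y>,  X(a)|y> = |y + a>. *)
Definition lbl_sub (p N : nat) (x a : basis_lbl p N) : basis_lbl p N :=
  [ffun i => x i - a i].

Definition pauli (p N : nat) (a b : basis_lbl p N) (v : qstate p N) : qstate p N :=
  [ffun x => omega p ^+ (nat_of_ord (zdot b (lbl_sub x a))) * v (lbl_sub x a)].

Definition qweight (p N : nat) (a b : basis_lbl p N) : nat :=
  #|[set i | (a i != 0) || (b i != 0)]|.

Definition inner (p N : nat) (u v : qstate p N) : algC :=
  \sum_x ((u x)^* * v x).

(* Q detects E iff P_Q E P_Q is a scalar multiple of P_Q, i.e.
   <u|E|v> = c_E <u|v> for all u, v in Q *)
Definition detects (p N : nat) (Q : {vspace qstate p N}) (a b : basis_lbl p N) :=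
  exists c : algC, forall u v, u \in Q -> v \in Q ->
    inner u (pauli a b v) = c * inner u v.

Definition min_distance (p N : nat) (Q : {vspace qstate p N}) (d : nat) :=
  (forall a b, (0 < qweight a b < d)%N -> detects Q a b) /\
  (exists a b, qweight a b = d /\ ~ detects Q a b).

Definition is_qcode (p N K d : nat) (Q : {vspace qstate p N}) :=
  \dim Q = (p ^ K)%N /\ min_distance Q d.

Definition is_pure_qcode (p N K d : nat) (Q : {vspace qstate p N}) :=
  @is_qcode p N K d Q /\
  (forall a b, (0 < qweight a b < d)%N ->
     forall u v, u \in Q -> v \in Q -> inner u (pauli a b v) = 0).

Definition qhamming_bound (p N K d : nat) : Prop :=
  (\sum_(j < ((d - 1) %/ 2).+1) 'C(N, j) * (p ^ 2 - 1) ^ j <= p ^ (N - K))%N.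

(* the quantum Hamming bound certifies that an [[N,K,d]]_p code is optimal
   (the bound excludes [[N,K,d+1]]) or almost optimal (it excludes
   [[N,K,d+2]], so any [[N,K,d+1]] code would be optimal). *)
Definition qhamming_at_least_almost_optimal (p N K d : nat) : Prop :=
  ~ qhamming_bound p N K d.+1 \/ ~ qhamming_bound p N K d.+2.

Arguments is_qcode : clear implicits.
Arguments is_pure_qcode : clear implicits.

(* Main.v *)
(* A stabilizer code is the range of the projector P = |S|^-1 sum_(s in S) W(s),
   where S is an isotropic group of pairs (a, b) in F_3^N x F_3^N and W(a, b) is
   X(a)Z(b) with the phase that makes W multiplicative on S.  Its dimension
   tr P = 3^N / |S| is computed from tr W(s) = 0 for s <> 0.

   Write F_9 = F_3(i) with i^2 = -1 and let z_j = x_j + i w_j (j < N) be points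
   of F_9^m, m = n - 1, that are pairwise independent over F_9 and satisfy
   sum_j z_j^t conj(z_j) = 0 (here even each real and imaginary part of the sum
   vanishes separately).  The code they span is Hermitian self-orthogonal of
   F_3-dimension 2m, and an error of weight 1 or 2 commuting with it would be an
   F_9-dependency between at most two points.  So the code is pure
   [[N, N - 2m, >= 3]]_3, and a line x, y, x + y of real points gives an
   undetected error of weight 3.

   With J the representatives of PG(m - 1, 3) and A, contained in J, an affine flat
   of dimension k - 1 where k = (n + s)/2, the three families of points are J,
   J minus A, and J together with the translate A + i e_k; the quadratic sums
   over J and over A vanish mod 3 because both sets (J up to sign) are unions of
   cosets of a plane. *)
From HB Require Import structures.
Require Import Defs.
From mathcomp Require Import all_boot all_order all_algebra all_field.
From mathcomp Require Import ring zify.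
Set Implicit Arguments. Unset Strict Implicit. Unset Printing Implicit Defensive.
Import Order.TTheory GRing.Theory Num.Theory.
Local Open Scope ring_scope.

(** * Arithmetic in F_3 *)

Lemma Z3_add3 (x : 'Z_3) : x + x + x = 0.
Proof. by case: x => [[|[|[|?]]] ?] //; apply: val_inj. Qed.

Lemma Z3_cases (c : 'Z_3) : [\/ c = 0, c = 1 | c = -1].
Proof.
by case: c => [[|[|[|?]]] ?] //; [apply: Or31|apply: Or32|apply: Or33]; apply: val_inj.
Qed.

Lemma Z3_double_eq0 (c : 'Z_3) : c + c = 0 -> c = 0.
Proof. by move=> c2; rewrite -[LHS]addr0 -{1}c2 addrA Z3_add3. Qed.

Lemma Z3_sqr (c : 'Z_3) : c != 0 -> c * c = 1.
Proof. by case: (Z3_cases c) => -> // _; apply: val_inj. Qed.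

Lemma Z3_mulIf (c d d' : 'Z_3) : c != 0 -> d * c = d' * c -> d = d'.
Proof. by move/Z3_sqr=> cc e; rewrite -[d]mulr1 -cc mulrA e -mulrA cc mulr1. Qed.

(** Holds because -1 is not a square mod 3, which is also what makes F_3(i) a field. *)
Lemma Z3_sqr_eq0 (c d : 'Z_3) : c * c + d * d = 0 -> c = 0 /\ d = 0.
Proof. by case: (Z3_cases c) => ->; case: (Z3_cases d) => ->. Qed.

(** * Stabilizer codes *)

Section Trace.
Variables (K : fieldType) (I : finType) (T : 'End({ffun I -> K^o})).
Hypothesis T_idem : forall v, T (T v) = T v.

Definition delta (i : I) : {ffun I -> K^o} := [ffun j => (i == j)%:R].

Lemma ffun_delta (v : {ffun I -> K^o}) : v = \sum_i v i *: delta i.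
Proof.
apply/ffunP => j; rewrite sum_ffunE (bigD1 j) //= big1 => [|i ij].
  by rewrite !ffunE eqxx addr0 /GRing.scale /= mulr1.
by rewrite !ffunE (negbTE ij) /GRing.scale /= mulr0.
Qed.

(** Expanding each [T (delta i)] in a basis of the image and exchanging the sums leaves the diagonal
    coordinates of [T] on that basis, all equal to 1. *)
Lemma trace_idem : \sum_i T (delta i) i = (\dim (limg T))%:R.
Proof.
set U := limg T; pose e := vbasis U.
have TU v : T v \in U by rewrite memv_img ?memvf.
have TidU v : v \in U -> T v = v by case/memv_imgP=> w _ ->.
have eU (j : 'I_(\dim U)) : e`_j \in U by rewrite vbasis_mem ?mem_nth ?size_tuple.
transitivity (\sum_i \sum_(j < \dim U) coord e j (T (delta i)) * (e`_j : {ffun I -> K^o}) i).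
  apply: eq_bigr => i _; rewrite {1}(coord_vbasis (TU (delta i))) sum_ffunE.
  by apply: eq_bigr => j _; rewrite ffunE.
rewrite exchange_big /=.
have -> : (\dim U)%:R = \sum_(j < \dim U) (1 : K) by rewrite sumr_const card_ord.
apply: eq_bigr => j _.
transitivity (coord e j (T e`_j)).
  rewrite {2}(ffun_delta e`_j) !linear_sum; apply: eq_bigr => i _.
  by rewrite !linearZ /= mulrC.
by rewrite TidU // coord_free ?eqxx // (basis_free (vbasisP U)).
Qed.
End Trace.

(** * The additive character of F_3 *)

Definition chi (x : 'Z_3) : algC := omega 3 ^+ (x : nat).

Lemma omega_prim p : (0 < p)%N -> p.-primitive_root (omega p).
Proof.
rewrite /omega; destruct (ltnP 0 p) as [h|] => // _.
exact: (proj2_sig (C_prim_root_exists h)).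
Qed.

Definition omega3_prim := @omega_prim 3 isT.

Lemma chiD x y : chi (x + y) = chi x * chi y.
Proof. by rewrite /chi -exprD /= (prim_expr_mod omega3_prim). Qed.

Lemma chi0 : chi 0 = 1. Proof. by []. Qed.

Lemma chi_eq1 x : (chi x == 1) = (x == 0).
Proof.
rewrite /chi -(prim_order_dvd omega3_prim) -val_eqE /=.
by case: x => [[|[|[|?]]] ?].
Qed.

Lemma chiNl x : chi (- x) * chi x = 1.
Proof. by rewrite -chiD addNr. Qed.

Lemma chi_neq0 x : chi x != 0.
Proof. by apply/eqP=> c0; have /eqP := chiNl x; rewrite c0 mulr0 eq_sym oner_eq0. Qed.

Lemma chi_conj x : (chi x)^* = chi (- x).
Proof.
have n1 : `|chi x| = 1.
  apply/eqP; rewrite -(@pexpr_eq1 _ _ 3) // -normrX /chi exprAC.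
  by rewrite (prim_expr_order omega3_prim) expr1n normr1.
apply: (mulIf (chi_neq0 x)); rewrite chiNl mulrC -normCK n1 expr1n //.
Qed.

(** * Pauli and Weyl operators *)

Section Weyl.
Variable N : nat.
Notation lbl := (basis_lbl 3 N).
Implicit Types (s t : lbl * lbl) (u v : qstate 3 N).

Lemma zdotDl (a b x : lbl) : zdot (a + b) x = zdot a x + zdot b x.
Proof. by rewrite -big_split; apply: eq_bigr => i _; rewrite ffunE mulrDl. Qed.

Lemma zdotC (a b : lbl) : zdot a b = zdot b a.
Proof. by apply: eq_bigr => i _; rewrite mulrC. Qed.

Lemma zdotDr (a x y : lbl) : zdot a (x + y) = zdot a x + zdot a y.
Proof. by rewrite zdotC zdotDl !(zdotC _ a). Qed.

Lemma zdotNl (a x : lbl) : zdot (- a) x = - zdot a x.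
Proof. by rewrite -sumrN; apply: eq_bigr => i _; rewrite ffunE mulNr. Qed.

Lemma zdotNr (a x : lbl) : zdot a (- x) = - zdot a x.
Proof. by rewrite zdotC zdotNl zdotC. Qed.

Lemma zdot0l (x : lbl) : zdot 0 x = 0.
Proof. by apply: big1 => i _; rewrite ffunE mul0r. Qed.

Lemma zdot0r (x : lbl) : zdot x 0 = 0.
Proof. by rewrite zdotC zdot0l. Qed.

Definition unit_lbl (i : 'I_N) : lbl := [ffun j => (i == j)%:R].

Lemma zdot_unit i (x : lbl) : zdot (unit_lbl i) x = x i.
Proof.
rewrite /zdot (bigD1 i) //= ffunE eqxx mul1r big1 ?addr0 // => j /negbTE ji.
by rewrite ffunE eq_sym ji mul0r.
Qed.

(** The symplectic form; its character value is the commutator of two Pauli operators. *)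
Definition symp s t : 'Z_3 := zdot s.2 t.1 - zdot t.2 s.1.

Definition pauli_op s v : qstate 3 N := pauli s.1 s.2 v.

Lemma pauli_opE s v x : pauli_op s v x = chi (zdot s.2 (x - s.1)) * v (x - s.1).
Proof.
rewrite ffunE; have -> // : lbl_sub x s.1 = x - s.1.
by apply/ffunP => i; rewrite !ffunE.
Qed.

Fact pauli_op_linear s : linear (pauli_op s).
Proof.
move=> c u v; apply/ffunP => x; rewrite !(ffunE, pauli_opE) mulrDr.
by congr (_ + _); rewrite /GRing.scale /= mulrCA.
Qed.
HB.instance Definition _ s :=
  GRing.isLinear.Build algC (qstate 3 N) (qstate 3 N) _ (pauli_op s) (pauli_op_linear s).

Lemma pauli_op0 v : pauli_op 0 v = v.
Proof. by apply/ffunP => x; rewrite pauli_opE zdot0l chi0 mul1r subr0. Qed.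

Lemma pauli_opM s t v :
  pauli_op s (pauli_op t v) = chi (zdot s.2 t.1) *: pauli_op (s + t) v.
Proof.
apply/ffunP => x; rewrite [RHS]ffunE !pauli_opE /GRing.scale /= opprD addrA !mulrA -!chiD.
congr (chi _ * _); rewrite !(zdotDl, zdotDr, zdotNr); ring.
Qed.

Lemma pauli_op_comm s t v :
  pauli_op s (pauli_op t v) = chi (symp s t) *: pauli_op t (pauli_op s v).
Proof. by rewrite !pauli_opM scalerA -chiD subrK addrC. Qed.

Definition weyl s v : qstate 3 N := chi (- zdot s.2 s.1) *: pauli_op s v.

Lemma weylE s v x :
  weyl s v x = chi (- zdot s.2 s.1) * (chi (zdot s.2 (x - s.1)) * v (x - s.1)).
Proof. by rewrite ffunE pauli_opE. Qed.

Fact weyl_linear s : linear (weyl s).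
Proof. by move=> c u v; rewrite /weyl linearP scalerDr !scalerA mulrC. Qed.
HB.instance Definition _ s :=
  GRing.isLinear.Build algC (qstate 3 N) (qstate 3 N) _ (weyl s) (weyl_linear s).

(* The phase uses -1 = 1/2 in F_3; it makes [weyl] multiplicative on isotropic sets. *)
Lemma weylM s t v : symp s t = 0 -> weyl s (weyl t v) = weyl (s + t) v.
Proof.
move/eqP; rewrite subr_eq0 => /eqP st.
rewrite /weyl linearZ /= pauli_opM !scalerA -!chiD; congr (chi _ *: _).
rewrite /= !zdotDl !zdotDr -st.
by rewrite -[LHS]addr0 -(Z3_add3 (- zdot s.2 t.1)); ring.
Qed.

Lemma weyl_pauli_comm s t v :
  weyl s (pauli_op t v) = chi (symp s t) *: pauli_op t (weyl s v).
Proof.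
by rewrite /weyl pauli_op_comm [in RHS]linearZ /= !scalerA mulrC.
Qed.

Lemma innerDr u v w : inner u (v + w) = inner u v + inner u w.
Proof. by rewrite -big_split; apply: eq_bigr => x _; rewrite ffunE mulrDr. Qed.

Lemma innerZr c u v : inner u (c *: v) = c * inner u v.
Proof. by rewrite mulr_sumr; apply: eq_bigr => x _; rewrite ffunE mulrCA. Qed.

Lemma inner_self_eq0 v : inner v v = 0 -> v = 0.
Proof.
move=> /eqP; rewrite psumr_eq0 => [/allP v0|x _]; last by rewrite mulrC -normCK exprn_ge0.
apply/ffunP => x; rewrite [RHS]ffunE; apply/eqP.
have /implyP := v0 x (mem_index_enum x).
by rewrite mulrC -normCK expf_eq0 /= normr_eq0; apply.
Qed.

(** Unitarity: [weyl s] only translates the labels and multiplies by cube roots of unity. *)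
Lemma inner_weyl s u v : inner (weyl s u) (weyl s v) = inner u v.
Proof.
rewrite /inner [RHS](reindex_inj (addIr (- s.1))) /=; apply: eq_bigr => x _.
have unit z (c d : algC) : (chi z * c)^* * (chi z * d) = c^* * d.
  by rewrite rmorphM /= chi_conj mulrACA chiNl mul1r.
by rewrite !weylE !unit.
Qed.

(** * The code fixed by an isotropic group *)

Section Stabilizer.
Variable S : {set lbl * lbl}.
Hypotheses (S0 : 0 \in S) (SD : forall s t, s \in S -> t \in S -> s + t \in S).
Hypothesis S_iso : forall s t, s \in S -> t \in S -> symp s t = 0.

Definition proj v : qstate 3 N := (#|S|%:R^-1 : algC) *: \sum_(s in S) weyl s v.

Fact proj_linear : linear proj.
Proof.
move=> c u v; rewrite /proj.
under eq_bigr => s _ do rewrite linearP.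
by rewrite big_split /= scalerDr -scaler_sumr !scalerA mulrC.
Qed.
HB.instance Definition _ :=
  GRing.isLinear.Build algC (qstate 3 N) (qstate 3 N) _ proj proj_linear.

Definition code : {vspace qstate 3 N} := limg (linfun proj).

Lemma card_S_neq0 : #|S|%:R != 0 :> algC.
Proof. by rewrite pnatr_eq0 -lt0n; apply/card_gt0P; exists 0. Qed.

Lemma weyl_proj s v : s \in S -> weyl s (proj v) = proj v.
Proof.
move=> sS; rewrite /proj linearZ linear_sum /=; congr (_ *: _).
have Sadd t : (s + t \in S) = (t \in S).
  apply/idP/idP => [stS|]; last exact: SD.
  (* In characteristic 3 the inverse of [s] is [s + s], so closure under addition suffices. *)
  have -> : t = s + (s + (s + t)).
    rewrite !addrA -[LHS]add0r; congr (_ + _).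
    apply/esym; rewrite [s]surjective_pairing; congr (_, _).
      by apply/ffunP => i; rewrite !ffunE /= Z3_add3.
    by apply/ffunP => i; rewrite !ffunE /= Z3_add3.
  exact: SD sS (SD sS stS).
rewrite [RHS](reindex_inj (addrI s)) /=; apply: eq_big => t; first by rewrite Sadd.
by move=> tS; rewrite weylM ?S_iso.
Qed.

Lemma proj_fix v : (forall s, s \in S -> weyl s v = v) -> proj v = v.
Proof.
move=> fv; rewrite /proj (eq_bigr (fun=> v)) => [|s sS]; last exact: fv.
by rewrite sumr_const -scaler_nat scalerA mulVf ?scale1r ?card_S_neq0.
Qed.

Lemma codeP v : reflect (forall s, s \in S -> weyl s v = v) (v \in code).
Proof.
apply: (iffP memv_imgP) => [[w _ ->] s sS|fv]; first by rewrite lfunE /= weyl_proj.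
by exists v; rewrite ?memvf // lfunE /= proj_fix.
Qed.

(** Translating [x] by a unit vector at a position where [b] is nonzero multiplies the sum by a
    value of [chi] other than 1. *)
Lemma sum_chi_zdot (b : lbl) : b != 0 -> \sum_x chi (zdot b x) = 0.
Proof.
move=> b0; have [i bi] : exists i, b i != 0.
  apply/existsP; apply: contraNT b0; rewrite negb_exists => /forallP b0.
  by apply/eqP/ffunP => i; rewrite ffunE; apply/eqP; rewrite -[_ == _]negbK b0.
have : \sum_x chi (zdot b x) = chi (b i) * \sum_x chi (zdot b x).
  rewrite {1}(reindex_inj (addrI (unit_lbl i))) /= mulr_sumr; apply: eq_bigr => x _.
  by rewrite zdotDr (zdotC b (unit_lbl i)) zdot_unit chiD.
move/eqP; rewrite -subr_eq0 -{1}[\sum_x _]mul1r -mulrBl mulf_eq0 subr_eq0 eq_sym.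
by rewrite chi_eq1 (negbTE bi) => /eqP.
Qed.

(** If [s.1] is nonzero, the translation fixes no label and the diagonal is zero; if only [s.2] is
    nonzero, the diagonal is a nontrivial character sum. *)
Lemma trace_weyl s :
  \sum_x weyl s (delta _ x) x = if s == 0 then (3 ^ N)%:R else 0 :> algC.
Proof.
case: eqP => [->|s0].
  rewrite (eq_bigr (fun=> 1)) => [|x _].
    by rewrite sumr_const card_ffun !card_ord.
  by rewrite weylE !zdot0l oppr0 chi0 !mul1r subr0 ffunE eqxx.
have wE x : weyl s (delta _ x) x =
    chi (- zdot s.2 s.1) * (chi (zdot s.2 (x - s.1)) * (s.1 == 0)%:R).
  rewrite weylE ffunE; congr (_ * (_ * _%:R)).
  by rewrite -subr_eq0 opprB addrC subrK.
under eq_bigr => x _ do rewrite wE.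
have [s1|_] := eqVneq s.1 0; last by apply: big1 => x _; rewrite !mulr0.
under eq_bigr => x _ do rewrite mulr1 s1 subr0.
rewrite -mulr_sumr sum_chi_zdot ?mulr0 //; apply/eqP => s2.
by apply: s0; rewrite [s]surjective_pairing s1 s2.
Qed.

Lemma dim_code : (\dim code * #|S| = 3 ^ N)%N.
Proof.
have idem v : linfun proj (linfun proj v) = linfun proj v.
  by rewrite !lfunE /= proj_fix // => s; apply: weyl_proj.
have tr : \sum_x linfun proj (delta _ x) x = (#|S|%:R)^-1 * (3 ^ N)%:R :> algC.
  under eq_bigr => x _ do rewrite lfunE /= ffunE sum_ffunE /GRing.scale /=.
  rewrite -mulr_sumr exchange_big (bigD1 (0 : lbl * lbl)) //= trace_weyl eqxx big1 ?addr0 // => s.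
  by case/andP=> _ /negbTE s0; rewrite trace_weyl s0.
apply/eqP; rewrite -(eqr_nat algC) natrM -(trace_idem idem) tr mulrAC.
by rewrite mulVf ?mul1r ?card_S_neq0.
Qed.

(** [weyl s] is unitary and fixes both [u] and [v], so moving it past the error multiplies the inner
    product by a value of [chi] other than 1. *)
Lemma code_pure s t u v :
  s \in S -> symp s t != 0 -> u \in code -> v \in code -> inner u (pauli_op t v) = 0.
Proof.
move=> sS st /codeP uQ /codeP vQ; apply/eqP.
have : inner u (pauli_op t v) = chi (symp s t) * inner u (pauli_op t v).
  by rewrite -{1}(inner_weyl s) weyl_pauli_comm innerZr uQ ?vQ.
move/eqP; rewrite -subr_eq0 -{1}[inner _ _]mul1r -mulrBl mulf_eq0 subr_eq0 eq_sym.
by rewrite chi_eq1 (negbTE st).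
Qed.

Lemma pauli_code t v :
  (forall s, s \in S -> symp s t = 0) -> v \in code -> pauli_op t v \in code.
Proof.
move=> St /codeP vQ; apply/codeP => s sS.
by rewrite weyl_pauli_comm St // chi0 scale1r vQ.
Qed.

(** Both errors preserve the code. Detection would make the first act there as a scalar, hence
    commute with the second, against the nontrivial commutator. *)
Lemma code_undetected t t' :
  (forall s, s \in S -> symp s t = 0) -> (forall s, s \in S -> symp s t' = 0) ->
  symp t t' != 0 -> ~ detects code t.1 t.2.
Proof.
move=> St St' tt' [c det].
(* Detection is applied with [u] equal to [pauli_op t v - c *: v], which lies in the code; its norm
   comes out as zero. *)
have scal v : v \in code -> pauli_op t v = c *: v.
  move=> vQ; apply/eqP; rewrite -subr_eq0; apply/eqP/inner_self_eq0.
  have dQ : pauli_op t v - c *: v \in code by rewrite rpredB ?rpredZ ?pauli_code.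
  have := det _ _ dQ vQ; rewrite -/(pauli_op t v).
  by move: {1 2 3}(_ - _) => d e; rewrite innerDr -scaleNr innerZr e mulNr subrr.
have [v vQ v0] : exists2 v, v \in code & v != 0.
  exists (vpick code); first exact: memv_pick.
  rewrite vpick0; apply/eqP => Q0; have := dim_code; rewrite Q0 dimv0 mul0n => /esym/eqP.
  by rewrite expn_eq0.
have unscale x y (w : qstate 3 N) : x *: w = y *: w -> x != y -> w = 0.
  move/eqP; rewrite -subr_eq0 -scalerBl scaler_eq0 subr_eq0 => /orP[->//|/eqP->//].
have inj x w : pauli_op x w = 0 -> w = 0.
  move/(congr1 (pauli_op (- x))); rewrite linear0 pauli_opM addNr pauli_op0 => /eqP.
  by rewrite scaler_eq0 (negbTE (chi_neq0 _)) => /eqP.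
have c0 : c != 0.
  apply: contraNneq v0 => c0; apply/eqP/(inj t); by rewrite scal // c0 scale0r.
have t'v : pauli_op t' v \in code by apply: pauli_code.
have := pauli_op_comm t t' v; rewrite !scal // linearZ /= scalerA => eq_cc.
case/eqP: v0; apply/(inj t')/(unscale _ _ _ eq_cc).
rewrite -{1}[c]mul1r -subr_eq0 -mulrBl mulf_neq0 //.
by rewrite subr_eq0 eq_sym chi_eq1.
Qed.
End Stabilizer.
End Weyl.

(** * Codes from point sets over F_9 *)

Section PointCode.
Variables (m : nat) (Z : {set basis_lbl 3 m * basis_lbl 3 m}).
Notation V := (basis_lbl 3 m).
Notation lbl := (basis_lbl 3 #|Z|).

(* Read in F_9: if (b - i a) z + (b' - i a') z' = 0 then b - i a = 0. *)
Hypothesis Z_indep : forall (z z' : V * V) (a b a' b' : 'Z_3),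
  z \in Z -> z' \in Z -> z != z' ->
  (forall i, b * z.1 i + a * z.2 i + (b' * z'.1 i + a' * z'.2 i) = 0) ->
  (forall i, b * z.2 i - a * z.1 i + (b' * z'.2 i - a' * z'.1 i) = 0) ->
  a = 0 /\ b = 0.
Hypotheses
  (Z_iso11 : forall c d : V, \sum_(z in Z) zdot c z.1 * zdot d z.1 = 0)
  (Z_iso12 : forall c d : V, \sum_(z in Z) zdot c z.1 * zdot d z.2 = 0)
  (Z_iso22 : forall c d : V, \sum_(z in Z) zdot c z.2 * zdot d z.2 = 0).
Hypothesis Z_span : forall c : V, (forall x, (x, 0) \in Z -> zdot c x = 0) -> c = 0.
Variables x y t : V.
Hypotheses (xZ : (x, 0) \in Z) (yZ : (y, 0) \in Z) (xyZ : (x + y, 0) \in Z)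
  (tZ : (t, 0) \in Z) (xtZ : (x + t, 0) \in Z).
Hypothesis xyt_uniq : uniq [:: x; y; x + y; t; x + t].

(* A label (a, b) encodes b - i a in F_9^N; then [gen l] is l * conj z_j
   for the element l.2 - i l.1 of F_9^m. *)
Definition gen (l : V * V) : lbl * lbl :=
  ([ffun j => zdot l.1 (enum_val j).1 + zdot l.2 (enum_val j).2],
   [ffun j => zdot l.2 (enum_val j).1 - zdot l.1 (enum_val j).2]).

Definition gens : {set lbl * lbl} := [set gen l | l : V * V].

Lemma genD l l' : gen (l + l') = gen l + gen l'.
Proof.
by congr (_, _); apply/ffunP => j; rewrite !ffunE /= !zdotDl; ring.
Qed.

(** The positions of real points [(u, 0)] read off [l.1] and [l.2] separately, and these points
    span. *)
Lemma gen_inj : injective gen.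
Proof.
move=> l l' [/ffunP e1 /ffunP e2].
have span (c c' : V) : (forall u, (u, 0) \in Z -> zdot c u = zdot c' u) -> c = c'.
  move=> e; apply/eqP; rewrite -subr_eq0; apply/eqP/Z_span => u uZ.
  by rewrite zdotDl zdotNl e // subrr.
rewrite [l]surjective_pairing [l']surjective_pairing; congr (_, _); apply: span => u uZ.
  have := e1 (enum_rank_in uZ (u, 0)); rewrite !ffunE enum_rankK_in //=.
  by rewrite !zdot0r !addr0.
have := e2 (enum_rank_in uZ (u, 0)); rewrite !ffunE enum_rankK_in //=.
by rewrite !zdot0r !subr0.
Qed.

Lemma card_gens : #|gens| = (3 ^ (2 * m))%N.
Proof.
rewrite card_imset ?cardT -?cardE ?card_prod ?card_ffun ?card_ord; last exact: gen_inj.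
by rewrite -expnD addnn mul2n.
Qed.

Lemma gens0 : 0 \in gens.
Proof.
apply/imsetP; exists (0, 0) => //.
by congr (_, _); apply/ffunP => j; rewrite !ffunE /= !zdot0l ?addr0 ?subr0.
Qed.

Lemma gensD s s' : s \in gens -> s' \in gens -> s + s' \in gens.
Proof.
by move=> /imsetP[l _ ->] /imsetP[l' _ ->]; rewrite -genD imset_f.
Qed.

Lemma sum_pt (R : nmodType) (F : V * V -> R) :
  \sum_(j < #|Z|) F (enum_val j) = \sum_(z in Z) F z.
Proof. by apply/esym; apply: big_enum_val. Qed.

(** Each of the two terms of [symp] vanishes on its own, since it expands into four quadratic sums
    over the points. *)
Lemma gens_iso s s' : s \in gens -> s' \in gens -> symp s s' = 0.
Proof.
have iso l l' : zdot (gen l).2 (gen l').1 = 0.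
  rewrite /zdot /=; under eq_bigr => j _ do rewrite !ffunE.
  rewrite (sum_pt (fun z => (zdot l.2 z.1 - zdot l.1 z.2) * (zdot l'.1 z.1 + zdot l'.2 z.2))).
  transitivity (\sum_(z in Z) (zdot l.2 z.1 * zdot l'.1 z.1)
    + \sum_(z in Z) (zdot l.2 z.1 * zdot l'.2 z.2)
    - \sum_(z in Z) (zdot l'.1 z.1 * zdot l.1 z.2)
    - \sum_(z in Z) (zdot l.1 z.2 * zdot l'.2 z.2)).
    by rewrite -!sumrN -!big_split /=; apply: eq_bigr => z _; ring.
  by rewrite Z_iso11 !Z_iso12 Z_iso22; ring.
by move=> /imsetP[l _ ->] /imsetP[l' _ ->]; rewrite /symp !iso subr0.
Qed.

Lemma card_Z_gt1 : (1 < #|Z|)%N.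
Proof.
pose p : V * V := (x, 0); pose q : V * V := (y, 0).
rewrite (cardsD1 p Z) (cardsD1 q (Z :\ p)) xZ !inE yZ xpair_eqE eqxx !andbT.
by case/and3P: xyt_uniq; rewrite inE [_ == y]eq_sym => /norP[->].
Qed.

Lemma gens_detect (a b : lbl) :
  (0 < qweight a b < 3)%N -> exists2 s, s \in gens & symp s (a, b) != 0.
Proof.
move=> /andP[]; rewrite /qweight; set D := [set i | _] => D_gt0 D_lt3.
have [j jD] := card_gt0P D_gt0.
(* The support lies in {j, j'}; for weight 1, [j'] is any other position, which exists by
   [card_Z_gt1]. *)
have [j' jj' Djj'] : exists2 j', j != j' & forall i, i != j -> i != j' -> i \notin D.
  have : (#|D :\ j| <= 1)%N by move: D_lt3; rewrite (cardsD1 j) jD.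
  have [D0 _|[j' /setD1P[j'j j'D]]] := set_0Vmem (D :\ j).
    have /card_gt0P[j'] : (0 < #|[set~ j]|)%N.
      by rewrite cardsC1 card_ord -subn1 subn_gt0 card_Z_gt1.
    rewrite !inE => j'j; exists j'; first by rewrite eq_sym.
    by move=> i ij _; have := in_set0 i; rewrite -D0 in_setD1 ij => /negbT.
  move=> D1; exists j'; first by rewrite eq_sym.
  move=> i ij ij'; apply: contraTN D1 => iD; rewrite -ltnNge.
  apply: (@leq_trans #|[set i; j']|); first by rewrite cards2 ij'.
  apply: subset_leq_card; apply/subsetP => k /set2P[] ->; rewrite !inE ?ij ?j'j //=.
    by move: iD; rewrite inE.
  by move: j'D; rewrite inE.
case: (pickP (fun s => (s \in gens) && (symp s (a, b) != 0))) => [s /andP[]|none].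
  by exists s.
have syn l : symp (gen l) (a, b) = 0.
  by apply/eqP; have := none (gen l); rewrite imset_f //= => /negbFE.
have ab_out i : i != j -> i != j' -> a i = 0 /\ b i = 0.
  by move=> ij ij'; have := Djj' i ij ij'; rewrite inE negb_or !negbK => /andP[/eqP-> /eqP->].
pose f (l : V * V) i := (zdot l.2 (enum_val i).1 - zdot l.1 (enum_val i).2) * a i
    - b i * (zdot l.1 (enum_val i).1 + zdot l.2 (enum_val i).2).
have f0 l : f l j + f l j' = 0.
  rewrite -(syn l) /symp /zdot -sumrB (bigD1 j) //=.
  rewrite (bigD1 j') 1?eq_sym //= big1 => [|i /andP[ij ij']].
    by rewrite addr0 !ffunE.
  by have [-> ->] := ab_out i ij ij'; rewrite !(mulr0, mul0r) subr0.
have [|||||aj bj] := Z_indep (z := enum_val j) (z' := enum_val j')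
  (a := a j) (b := b j) (a' := a j') (b' := b j').
- exact: enum_valP.
- exact: enum_valP.
- by rewrite (inj_eq enum_val_inj).
(* The generators of (e_i, 0) and (0, e_i) give, up to sign, the i-th coordinates of the two
   equations in [Z_indep]. *)
- move=> i; have := f0 (unit_lbl i, 0); rewrite /f /= !zdot_unit !zdot0l => e.
  by apply: oppr_inj; rewrite oppr0 -[RHS]e; ring.
- move=> i; have := f0 (0, unit_lbl i); rewrite /f /= !zdot_unit !zdot0l => e.
  by apply: oppr_inj; rewrite oppr0 -[RHS]e; ring.
by move: jD; rewrite inE aj bj eqxx.
Qed.

(** The dependency u + v - (u + v) = 0 of three collinear points, written as a word on the points;
    every linear functional sums to zero against it. *)
Definition line_word (u v : V) (z : V * V) : 'Z_3 :=
  (z == (u, 0))%:R + (z == (v, 0))%:R - (z == (u + v, 0))%:R.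
Definition line_lbl u v : lbl := [ffun j => line_word u v (enum_val j)].
Definition X_error : lbl * lbl := (line_lbl x y, 0).
Definition Z_error : lbl * lbl := (0, line_lbl x t).

Lemma sum_indic (F : V * V -> 'Z_3) z : z \in Z -> \sum_(z' in Z) F z' * (z' == z)%:R = F z.
Proof.
move=> zZ; rewrite (bigD1 z) //= eqxx mulr1 big1 ?addr0 // => z' /andP[_ /negbTE->].
by rewrite mulr0.
Qed.

Lemma sum_line (F : V * V -> 'Z_3) u v : (u, 0) \in Z -> (v, 0) \in Z -> (u + v, 0) \in Z ->
  \sum_(z in Z) F z * line_word u v z = F (u, 0) + F (v, 0) - F (u + v, 0).
Proof.
move=> uZ vZ uvZ; rewrite -(sum_indic F uZ) -(sum_indic F vZ) -(sum_indic F uvZ).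
rewrite -sumrN -!big_split /=; apply: eq_bigr => z _; rewrite /line_word; ring.
Qed.

Lemma X_error_undetected s : s \in gens -> symp s X_error = 0.
Proof.
case/imsetP=> l _ ->; rewrite /symp zdot0l subr0 /zdot.
under eq_bigr => j _ do rewrite !ffunE.
rewrite (sum_pt (fun z => (zdot l.2 z.1 - zdot l.1 z.2) * line_word x y z)) sum_line //=.
by rewrite !zdot0r zdotDr; ring.
Qed.

Lemma Z_error_undetected s : s \in gens -> symp s Z_error = 0.
Proof.
case/imsetP=> l _ ->; rewrite /symp zdot0r sub0r zdotC /zdot.
under eq_bigr => j _ do rewrite !ffunE.
rewrite (sum_pt (fun z => (zdot l.1 z.1 + zdot l.2 z.2) * line_word x t z)) sum_line //=.
by rewrite !zdot0r zdotDr; ring.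
Qed.

(** The two lines meet only in [x], where both words are 1, so the product is -1. This is the
    noncommuting pair that [code_undetected] asks for. *)
Lemma X_Z_error_symp : symp X_error Z_error != 0.
Proof.
have neq u v : u != v -> ((u, 0 : V) == (v, 0 : V)) = false.
  by rewrite xpair_eqE => /negbTE->.
have := xyt_uniq; rewrite /= !inE !negb_or => /andP[/and4P[xy xxy xt xxt]].
case/andP=> /and3P[_ yt yxt] /andP[/andP[xyt xyxt] _].
rewrite /symp zdot0l sub0r /zdot.
under eq_bigr => j _ do rewrite !ffunE.
rewrite (sum_pt (fun z => line_word x t z * line_word x y z)) sum_line // /line_word.
by rewrite eqxx !neq // 1?eq_sym.
Qed.

Lemma X_error_weight : qweight X_error.1 X_error.2 = 3.
Proof.
pose p : V * V := (x, 0); pose q : V * V := (y, 0); pose r : V * V := (x + y, 0).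
have [pq pr qr] : [/\ p != q, p != r & q != r].
  move: xyt_uniq => /=; rewrite !inE !negb_or => /andP[/andP[xy /andP[xxy _]]].
  by case/andP=> /andP[yxy _] _; rewrite !xpair_eqE !eqxx !andbT.
have pqr : #|[set p; q; r]| = 3.
  by rewrite -setUA !cardsU1 cards1 !inE negb_or pq pr qr.
rewrite -[RHS]pqr /qweight -sum1dep_card big_mkcond /=.
transitivity (\sum_(z in Z) (line_word x y z != 0)%R)%N.
  apply: etrans (esym (big_enum_val _)); apply: eq_bigr => j _.
  by rewrite !ffunE eqxx orbF; case: (_ == _).
rewrite -sum1_card big_mkcond [RHS]big_mkcond /=; apply: eq_bigr => z _.
rewrite !inE /line_word -/p -/q -/r.
have [->|zp] := eqVneq z p; first by rewrite xZ (negbTE pq) (negbTE pr).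
have [->|zq] := eqVneq z q; first by rewrite yZ (negbTE qr).
have [->|zr] := eqVneq z r; first by rewrite xyZ.
by case: (z \in Z).
Qed.

Theorem point_code K : (K + 2 * m = #|Z|)%N ->
  exists Q : {vspace qstate 3 #|Z|}, is_pure_qcode 3 #|Z| K 3 Q.
Proof.
move=> KZ; pose Q := code gens; exists Q.
have pure a b : (0 < qweight a b < 3)%N -> forall u v, u \in Q -> v \in Q ->
    inner u (pauli a b v) = 0.
  move=> ab u v uQ vQ; have [s sS sab] := gens_detect ab.
  exact: (code_pure gens0 gensD gens_iso sS sab).
split; last exact: pure.
split; last split.
- apply/eqP; rewrite -(eqn_pmul2r (_ : 0 < 3 ^ (2 * m))%N) ?expn_gt0 //.
  by rewrite -{1}card_gens (dim_code gens0 gensD gens_iso) -KZ expnD.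
- by move=> a b ab; exists 0 => u v uQ vQ; rewrite mul0r (pure _ _ ab).
exists X_error.1, X_error.2; split; first exact: X_error_weight.
apply: (code_undetected gens0 gensD gens_iso X_error_undetected Z_error_undetected).
exact: X_Z_error_symp.
Qed.

End PointCode.

(** * Point sets in ternary projective space *)

Section LeadingOne.
Variable m : nat.
Notation V := (basis_lbl 3 m).

(** Picks one vector from each pair x, -x of nonzero vectors, hence one representative per
    projective point. *)
Definition leading_one : {set V} :=
  [set x : V | [exists i, (x i == 1) && [forall j : 'I_m, (j < i)%N ==> (x j == 0)]]].

Lemma leading_oneP (x : V) (i : 'I_m) :
  x i != 0 -> (forall j : 'I_m, (j < i)%N -> x j = 0) -> (x \in leading_one) = (x i == 1).
Proof.
move=> xi xlt; rewrite inE; apply/existsP/idP => [[i' /andP[xi' /forallP lt']]|xi1].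
  case: (ltngtP i i') => [ii'|i'i|/val_inj->//].
    by have := lt' i; rewrite ii' (negbTE xi).
  by move: xi'; rewrite xlt.
by exists i; rewrite xi1; apply/forallP => j; apply/implyP => /xlt->.
Qed.

Lemma leading_oneN (x : V) : x != 0 -> (- x \in leading_one) = (x \notin leading_one).
Proof.
move=> x0; have [i0 xi0] : exists i, x i != 0.
  apply/existsP; apply: contraNT x0; rewrite negb_exists => /forallP x0.
  by apply/eqP/ffunP => i; rewrite ffunE; apply/eqP; rewrite -[_ == _]negbK x0.
case: (arg_minnP (fun i : 'I_m => i : nat) (P := fun i => x i != 0) xi0) => i xi imin.
have xlt (j : 'I_m) : (j < i)%N -> x j = 0.
  by move=> ji; apply/eqP; apply: contraTT ji => /imin; rewrite -leqNgt.
rewrite (leading_oneP xi xlt) (@leading_oneP _ i); first last.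
- by move=> j ji; rewrite ffunE xlt // oppr0.
- by rewrite ffunE oppr_eq0.
rewrite ffunE; by case: (Z3_cases (x i)) xi => ->.
Qed.

Lemma leading_one0 : 0 \notin leading_one.
Proof. by rewrite inE negb_exists; apply/forallP => i; rewrite ffunE. Qed.

(** Stated over any [nmodType] to serve both the cardinality in nat and the sums in F_3. *)
Lemma sum_even (R : nmodType) (F : V -> R) : (forall x, F (- x) = F x) ->
  \sum_x F x = F 0 + (\sum_(x in leading_one) F x + \sum_(x in leading_one) F x).
Proof.
move=> FN; rewrite (bigD1 (0 : V)) //=; congr (_ + _).
rewrite (bigID (mem leading_one)) /=; congr (_ + _).
  by apply: eq_bigl => x; case: eqP => // ->; rewrite (negbTE leading_one0).
rewrite (reindex_inj (@oppr_inj V : injective (fun x : V => - x))) /=.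
apply: eq_big => [x|x _]; last exact: FN.
rewrite oppr_eq0; case: eqP => [->|/eqP x0]; first by rewrite (negbTE leading_one0).
by rewrite leading_oneN // negbK.
Qed.

Lemma card_leading_one : (#|leading_one|.*2.+1 = 3 ^ m)%N.
Proof.
have : (\sum_(x : V) 1 =
    1 + (\sum_(x in leading_one) 1 + \sum_(x in leading_one) 1))%N.
  exact: (@sum_even nat (fun=> 1%N) (fun _ => erefl)).
by rewrite !sum1_card card_ffun !card_ord addnn => ->.
Qed.

Definition shift_closed (A : {set V}) (i : 'I_m) := forall x, x \in A -> x + unit_lbl i \in A.

Lemma unit_lbl3 (i : 'I_m) (x : V) : x + unit_lbl i + unit_lbl i + unit_lbl i = x.
Proof.
rewrite -!addrA -[RHS]addr0; congr (_ + _).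
by apply/ffunP => j; rewrite !ffunE addrA Z3_add3.
Qed.

(** [A] is a union of cosets of the line spanned by [unit_lbl i], and each coset has one member with
    i-th coordinate 0. *)
Lemma sum_shift (R : nmodType) (F : V -> R) (A : {set V}) i : shift_closed A i ->
  \sum_(x in A) F x =
  \sum_(x in A | x i == 0) (F x + F (x + unit_lbl i) + F (x + unit_lbl i + unit_lbl i)).
Proof.
set e := unit_lbl i => Ae; have eA x : (x + e \in A) = (x \in A).
  apply/idP/idP => [xe|/Ae//]; rewrite -(unit_lbl3 i x); exact: Ae _ (Ae _ xe).
rewrite !big_split /= (bigID (fun x : V => x i == 0)) /= -addrA; congr (_ + _).
rewrite (bigID (fun x : V => x i == 1)) /=; congr (_ + _).
  rewrite (reindex_inj (addIr e)) /=; apply: eq_bigl => x.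
  by rewrite eA !ffunE eqxx; case: (Z3_cases (x i)) => ->; rewrite ?andbF ?andbT.
rewrite (reindex_inj (addIr (e + e))) /=; apply: eq_big => x; last by rewrite addrA.
by rewrite addrA !eA !ffunE eqxx; case: (Z3_cases (x i)) => ->; rewrite ?andbF ?andbT.
Qed.

(** Summing along direction [i] turns a product of two affine forms into a constant; summing that
    constant along direction [j] gives a multiple of 3. *)
Lemma sum_quadratic (A : {set V}) i j (a b : V) (c d : 'Z_3) : i != j ->
  shift_closed A i -> shift_closed A j ->
  \sum_(x in A) (zdot a x + c) * (zdot b x + d) = 0.
Proof.
move=> ij Ai Aj; rewrite (sum_shift _ Ai).
(* The translates by 0, e and 2e contribute (1 + 4) a_i b_i plus multiples of 3, and 5 = -1 mod
   3. *)
rewrite [LHS](eq_bigr (fun=> - (a i * b i))) => [|x _]; last first.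
  rewrite !zdotDr !(zdotC _ (unit_lbl i)) !zdot_unit.
  set p := zdot a x; set q := zdot b x.
  rewrite -[RHS]addr0 -(Z3_add3 ((p + c) * (q + d) + a i * (q + d) + (p + c) * b i
    + a i * b i + a i * b i)).
  ring.
(* The slice with i-th coordinate 0 is still closed under shifts in direction [j]. *)
pose A0 : {set V} := [set x : V in A | x i == 0].
rewrite (eq_bigl (fun x => x \in A0)) => [|x]; last by rewrite inE.
rewrite (sum_shift _ (_ : shift_closed A0 j)) => [|x].
  by apply: big1 => x _; apply: Z3_add3.
by rewrite !inE => /andP[/Aj-> /eqP xi]; rewrite !ffunE xi [j == i]eq_sym (negbTE ij).
Qed.

(** The summand is even, so twice the sum is the sum over the whole space, where [sum_quadratic]
    applies. *)
Lemma sum_leading_one (i j : 'I_m) (a b : V) : i != j ->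
  \sum_(x in leading_one) zdot a x * zdot b x = 0.
Proof.
move=> ij; apply: Z3_double_eq0.
transitivity (\sum_(x : V) zdot a x * zdot b x).
  rewrite (@sum_even _ (fun x => zdot a x * zdot b x)) => [|x]; last by rewrite !zdotNr mulrNN.
  by rewrite zdot0r mul0r add0r.
have T_closed l : shift_closed setT l by move=> x; rewrite !inE.
rewrite -[RHS](@sum_quadratic setT i j a b 0 0) //.
by apply: eq_big => x; rewrite ?inE ?addr0.
Qed.

(** * Affine flats *)

Section Flat.
Variables (i0 : 'I_m) (k : nat).
Definition affine_flat : {set V} :=
  [set x : V | (x i0 == 1) && [forall i : 'I_m, (k <= i)%N ==> (x i == 0)]].

Lemma affine_flat_shift i : i != i0 -> (i < k)%N -> shift_closed affine_flat i.
Proof.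
move=> ii0 ik x; rewrite !inE !ffunE (negbTE ii0) addr0 => /andP[-> /forallP x0].
apply/forallP => j; apply/implyP => kj; have := x0 j; rewrite kj !ffunE => /eqP->.
by have [eq_ij|_] := eqVneq i j; [move: kj; rewrite -eq_ij leqNgt ik|].
Qed.

Lemma card_affine_flat : i0 = 0%N :> nat -> (0 < k <= m)%N -> #|affine_flat| = (3 ^ k.-1)%N.
Proof.
move=> i00 /andP[k0 km].
(* The flat is a product: coordinate 0 is fixed to 1, coordinates 1 to k - 1 are free, the rest are
   0. *)
pose F (i : 'I_m) : pred 'Z_3 :=
  if i == 0%N :> nat then pred1 1 else if (i < k)%N then predT else pred1 0.
have -> : #|affine_flat| = #|(family F : {pred V})|.
  apply: eq_card => x; rewrite inE; apply/andP/familyP => [[/eqP x1 /forallP x0] i|xF].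
    rewrite /F; case: eqP => [i_0|_].
      by have -> : i = i0 by [apply: val_inj; rewrite /= i_0 i00]; rewrite inE x1.
    by case: ltnP => // ki; have := x0 i; rewrite ki inE.
  split; first by have := xF i0; rewrite /F i00 inE.
  apply/forallP => i; apply/implyP => ki; have := xF i.
  have i_gt0 : (0 < i)%N := leq_trans k0 ki.
  by rewrite /F gtn_eqF // ltnNge ki inE.
rewrite card_family foldrE big_map big_enum /=.
transitivity (\prod_(i < m) if (0 < i < k)%N then 3 else 1)%N.
  apply: eq_bigr => i _; rewrite /F; case: posnP => [_|i_gt0]; first by rewrite card1.
  by rewrite /=; case: ltnP => _; rewrite ?card1 // card_ord.
rewrite -(big_mkord xpredT (fun i => if (0 < i < k)%N then 3 else 1)%N).
rewrite -big_mkcond /= (big_cat_nat (n := k)) //= [X in (_ * X)%N]big_nat_cond.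
rewrite [X in (_ * X)%N]big_pred0 ?muln1; last first.
  by move=> i; apply/negP => /andP[/andP[ki _] /andP[_]]; rewrite ltnNge ki.
rewrite big_ltn_cond //= -subn1 -prod_nat_const_nat big_nat_cond [RHS]big_nat_cond.
by apply: eq_bigl => i; rewrite andbT; apply: andb_idr.
Qed.
End Flat.
End LeadingOne.

(** * Real points together with a translated flat *)

Section Config.
Variables (m : nat) (i0 i1 ik l : 'I_m).
Notation V := (basis_lbl 3 m).
Variables D B : {set V}.
Notation e := (unit_lbl ik : V).
Hypotheses (i0E : i0 = 0%N :> nat) (i1E : i1 = 1%N :> nat) (l_gt1 : (1 < l)%N).
Hypothesis ik_i0 : ik != i0.
(** [D] stands for [J] or [J] minus the flat, whose points have coordinate [i0] nonzero and
    coordinate [l] zero. [B] is the flat or empty; its sums take affine forms because all its points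
    get the same imaginary part [e]. *)
Hypotheses (D_sub : D \subset leading_one m)
  (D_big : forall x, x \in leading_one m -> (x i0 == 0) || (x l != 0) -> x \in D)
  (B_affine : forall x, x \in B -> x i0 = 1 /\ x ik = 0).
Hypotheses (D_sum : forall a b, \sum_(x in D) zdot a x * zdot b x = 0)
  (B_sum : forall a b c d, \sum_(x in B) (zdot a x + c) * (zdot b x + d) = 0).

(** Dependent nonzero vectors over F_3 agree up to sign, and [leading_one] never contains both x and
    -x. *)
Lemma leading_one_indep (x x' : V) (c c' : 'Z_3) :
  x \in leading_one m -> x' \in leading_one m -> x != x' ->
  (forall i, c * x i + c' * x' i = 0) -> c = 0.
Proof.
move=> xL x'L xx' cx.
have x0 : x != 0 by apply: contraTneq xL => ->; apply: leading_one0.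
have x'0 : x' != 0 by apply: contraTneq x'L => ->; apply: leading_one0.
have [//|/Z3_sqr cc] := eqVneq c 0.
have xE i : x i = - (c * c') * x' i.
  by rewrite -[LHS]mul1r -cc -[RHS]addr0 -[0](mulr0 c) -(cx i); ring.
case: (Z3_cases (- (c * c'))) xE => -> xE.
- by case/eqP: x0; apply/ffunP => i; rewrite xE mul0r ffunE.
- by case/eqP: xx'; apply/ffunP => i; rewrite xE mul1r.
have xN : x = - x' by apply/ffunP => i; rewrite xE mulN1r ffunE.
by move: xL; rewrite xN leading_oneN // x'L.
Qed.

Lemma leading_one_affine_indep (x y : V) (a b a' b' : 'Z_3) :
  x \in leading_one m -> y \in B ->
  (forall i, b * x i + (b' * y i + a' * e i) = 0) ->
  (forall i, - (a * x i) + (b' * e i - a' * y i) = 0) ->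
  [/\ a = 0, b = 0, a' = 0 & b' = 0].
Proof.
move=> xL yB e1 e2; have [y0 yk] := B_affine yB.
have ek : e ik = 1 by rewrite ffunE eqxx.
have e0 : e i0 = 0 by rewrite ffunE (negbTE ik_i0).
have := e1 ik; have := e2 ik; have := e1 i0; have := e2 i0.
rewrite y0 yk ek e0 !(mulr0, mulr1, addr0, add0r, subr0) => e20 e10 e2k e1k.
have b'0 : b' = - (b * x i0) by apply/eqP; rewrite -addr_eq0 addrC e10.
have b'k : b' = a * x ik by apply/eqP; rewrite -subr_eq0 addrC e2k.
have a'0 : a' = - (a * x i0) by apply/eqP; rewrite -addr_eq0 -oppr_eq0 opprD addrC e20.
have a'k : a' = - (b * x ik) by apply/eqP; rewrite -addr_eq0 addrC e1k.
(* Multiplying the two expressions for each unknown, a'^2 = a b x_i0 x_ik and b'^2 is its negative,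
   so the squares sum to 0. *)
have [a'z b'z] : a' = 0 /\ b' = 0.
  apply: Z3_sqr_eq0; rewrite {1}a'0 a'k {1}b'0 b'k; ring.
have x_neq0 : x != 0 by apply: contraTneq xL => ->; apply: leading_one0.
have scal0 c : (forall i, c * x i = 0) -> c = 0.
  move=> cx; have [//|c1|c1] := Z3_cases c; case/eqP: x_neq0; apply/ffunP => i.
    by rewrite -[x i]mul1r -c1 cx ffunE.
  by apply: oppr_inj; rewrite -mulN1r -c1 cx ffunE oppr0.
split=> //; apply: scal0 => i.
  by apply: oppr_inj; rewrite oppr0 -[RHS](e2 i) a'z b'z; ring.
by rewrite -(e1 i) a'z b'z; ring.
Qed.

Definition points : {set V * V} := [set (x, 0 : V) | x in D] :|: [set (x, e) | x in B].

Lemma sum_points (R : nmodType) (F : V * V -> R) :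
  \sum_(z in points) F z = \sum_(x in D) F (x, 0) + \sum_(x in B) F (x, e).
Proof.
have inj (f : V) (C : {set V}) : {in C & , injective (fun x : V => (x, f))} by move=> x x' _ _ [].
have e0 : e != 0 by apply/eqP => /ffunP/(_ ik); rewrite !ffunE eqxx.
rewrite (eq_bigl [in [predU [set (x, 0 : V) | x in D] & [set (x, e) | x in B]]]); last first.
  by move=> z; rewrite !inE.
rewrite bigU /=; last first.
  rewrite disjoints_subset; apply/subsetP => _ /imsetP[x _ ->]; rewrite inE.
  by apply/imsetP => -[x' _ [_ /esym/eqP]]; rewrite (negbTE e0).
by rewrite !big_imset.
Qed.

Lemma card_points : #|points| = (#|D| + #|B|)%N.
Proof.
rewrite -!sum1_card; exact: (@sum_points nat (fun=> 1%N)).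
Qed.

Theorem config_code K : (K + 2 * m = #|D| + #|B|)%N ->
  exists Q : {vspace qstate 3 (#|D| + #|B|)}, is_pure_qcode 3 (#|D| + #|B|) K 3 Q.
Proof.
rewrite -card_points.
have ul (i j : 'I_m) : (unit_lbl i : V) j = (i == j)%:R by rewrite ffunE.
have [i0l i1l i01] : [/\ i0 != l, i1 != l & i0 != i1].
  by rewrite -!val_eqE /= i0E i1E neq_ltn (ltnW l_gt1) neq_ltn l_gt1.
have [li0 li1 i1i0] : [/\ l != i0, l != i1 & i1 != i0].
  by rewrite ![_ == i0]eq_sym [_ == i1]eq_sym.
pose eqs := (eqxx, negbTE i0l, negbTE i1l, negbTE i01, negbTE li0, negbTE li1, negbTE i1i0,
  @mulr0n 'Z_3 1, @mulr1n 'Z_3 1, @add0r 'Z_3, @addr0 'Z_3).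
have inL (x : V) i : x i = 1 -> (forall j : 'I_m, (j < i)%N -> x j = 0) -> x \in leading_one m.
  by move=> xi xlt; rewrite (leading_oneP (i := i)) ?xi.
have unitL i : (unit_lbl i : V) \in leading_one m.
  apply: (inL _ i) => [|j ji]; rewrite ul ?eqxx //.
  by case: eqP ji => // ->; rewrite ltnn.
have DZ (x : V) : x \in D -> (x, 0) \in points.
  by move=> xD; apply/setUP; left; apply: imset_f.
(* These points, [x + y] and [x + t] each have coordinate [i0] zero or coordinate [l] nonzero, so
   [D_big] keeps them in [D] even when a flat has been removed. *)
pose x : V := unit_lbl l; pose y : V := unit_lbl i1; pose t : V := unit_lbl i0 + unit_lbl l.
have xE i : x i = (l == i)%:R by rewrite ul.
have yE i : y i = (i1 == i)%:R by rewrite ul.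
have tE i : t i = (i0 == i)%:R + (l == i)%:R by rewrite ffunE !ul.
have unitD i : i != i0 -> (unit_lbl i : V) \in D.
  by move=> ii0; rewrite D_big ?unitL // ul (negbTE ii0).
have xyD : x + y \in D.
  rewrite D_big //; last by rewrite ffunE xE yE !eqs.
  apply: (inL _ i1) => [|j]; first by rewrite ffunE xE yE !eqs.
  rewrite i1E ltnS leqn0 => /eqP j0; have -> : j = i0 by apply: val_inj; rewrite /= j0 i0E.
  by rewrite ffunE xE yE !eqs.
have tD : t \in D.
  rewrite D_big //; last by rewrite !tE !eqs orbT.
  by apply: (inL _ i0) => [|j]; rewrite ?i0E // tE !eqs.
have xtE i : (x + t) i = x i + t i by rewrite ffunE.
have xyE i : (x + y) i = x i + y i by rewrite ffunE.
have xtD : x + t \in D.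
  rewrite D_big //; last by rewrite !xtE !xE !tE !eqs orbT.
  by apply: (inL _ i0) => [|j]; rewrite ?i0E // xtE xE tE !eqs.
have V0 i : (0 : V) i = 0 by rewrite ffunE.
have neq (u v : V) i : u i != v i -> u != v by apply: contraNneq => ->.
apply: (@point_code _ _ _ _ _ _ _ x y t); try exact: DZ.
- move=> z z' a b a' b' /setUP[] /imsetP[u uD ->] /setUP[] /imsetP[u' u'D ->] /= uu' e1 e2.
  + have uu : u != u' by apply: contraNneq uu' => ->.
    have uL := subsetP D_sub u uD; have u'L := subsetP D_sub u' u'D.
    split; [apply: (leading_one_indep (c' := a') uL u'L uu) => i
           |apply: (leading_one_indep (c' := b') uL u'L uu) => i].
      by apply: oppr_inj; rewrite oppr0 -[RHS](e2 i) !V0; ring.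
    by rewrite -[RHS](e1 i) !V0; ring.
  + have uL := subsetP D_sub u uD.
    have [] // := leading_one_affine_indep uL u'D (a := a) (b := b) (a' := a') (b' := b') => i.
      by rewrite -[RHS](e1 i) !V0; ring.
    by rewrite -[RHS](e2 i) !V0; ring.
  + have u'L := subsetP D_sub u' u'D.
    have [] // := leading_one_affine_indep u'L uD (a := a') (b := b') (a' := a) (b' := b) => i.
      by rewrite -[RHS](e1 i) !V0; ring.
    by rewrite -[RHS](e2 i) !V0; ring.
  (* Two points of the translate: coordinates [i0] and [ik] force b' = -b and a' = -a, and a
     coordinate separating [u] from [u'] then kills [a] and [b]. *)
  + have [u0 uk] := B_affine uD; have [u'0 u'k] := B_affine u'D.
    have ek : (e : V) ik = 1 by rewrite ul eqxx.
    have e0 : (e : V) i0 = 0 by rewrite ul (negbTE ik_i0).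
    have b'E : b' = - b.
      have := e1 i0; rewrite u0 u'0 e0 => e1'.
      by apply/eqP; rewrite -addr_eq0 -[0]e1'; apply/eqP; ring.
    have a'E : a' = - a.
      have := e1 ik; rewrite uk u'k ek => e1'.
      by apply/eqP; rewrite -addr_eq0 -[0]e1'; apply/eqP; ring.
    have [i ui] : exists i, u i != u' i.
      apply/existsP; apply: contraNT uu'; rewrite negb_exists => /forallP uu'.
      by rewrite xpair_eqE eqxx andbT; apply/eqP/ffunP => i; apply/eqP; rewrite -[_ == _]negbK uu'.
    have d0 : u i - u' i != 0 by rewrite subr_eq0.
    split; apply: (Z3_mulIf d0); rewrite mul0r.
      by apply: oppr_inj; rewrite oppr0 -[RHS](e2 i) a'E b'E; ring.
    by rewrite -[RHS](e1 i) a'E b'E; ring.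
- move=> c d; rewrite sum_points /= D_sum add0r -[RHS](B_sum c d 0 0).
  by apply: eq_bigr => u _; rewrite !addr0.
- move=> c d; rewrite sum_points /= big1 ?add0r => [|u _]; last by rewrite zdot0r mulr0.
  by rewrite -[RHS](B_sum c 0 0 (zdot d e)); apply: eq_bigr => u _; rewrite zdot0l addr0 add0r.
- move=> c d; rewrite sum_points /= big1 ?add0r => [|u _]; last by rewrite !zdot0r mulr0.
  by rewrite -[RHS](B_sum 0 0 (zdot c e) (zdot d e)); apply: eq_bigr => u _; rewrite !zdot0l !add0r.
- move=> c c0.
  have ci i : i != i0 -> c i = 0.
    by move=> ii0; rewrite -(zdot_unit i) zdotC c0 // DZ // unitD.
  (* [unit_lbl i0] may be missing from [D], as it lies in the flat, so this coordinate is read off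
     from [t]. *)
  have ci0 : c i0 = 0.
    have := c0 t (DZ t tD).
    by rewrite zdotDr !(zdotC c) !zdot_unit (ci l) ?addr0 // eq_sym.
  by apply/ffunP => i; rewrite ffunE; case: (eqVneq i i0) => [->|/ci].
- exact/DZ/unitD.
- exact/DZ/unitD.
rewrite /= !inE !negb_or.
have [yl y1 y0] : [/\ y l = 0, y i1 = 1 & y i0 = 0] by rewrite !yE !eqs.
have [xl x1 x0] : [/\ x l = 1, x i1 = 0 & x i0 = 0] by rewrite !xE !eqs.
have [tl t1 t0] : [/\ t l = 1, t i1 = 0 & t i0 = 1] by rewrite !tE !eqs.
have xyl : (x + y) l = 1 by rewrite xyE xl yl addr0.
have xy1 : (x + y) i1 = 1 by rewrite xyE x1 y1 add0r.
have xy0 : (x + y) i0 = 0 by rewrite xyE x0 y0 add0r.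
have xtl : (x + t) l = -1 by rewrite xtE xl tl; apply: val_inj.
have xt0 : (x + t) i0 = 1 by rewrite xtE x0 t0 add0r.
rewrite (neq x y l) ?xl ?yl // (neq x (x + y) i1) ?x1 ?xy1 // (neq x t i0) ?x0 ?t0 //.
rewrite (neq x (x + t) i0) ?x0 ?xt0 // (neq y (x + y) l) ?yl ?xyl // (neq y t i0) ?y0 ?t0 //.
rewrite (neq y (x + t) i0) ?y0 ?xt0 // (neq (x + y) t i0) ?xy0 ?t0 //.
by rewrite (neq (x + y) (x + t) i0) ?xy0 ?xt0 // (neq t (x + t) l) ?tl ?xtl.
Qed.
End Config.

(** * The Hamming bound at distance 5 and the choice of parameters *)

Lemma hamming_5_violated (m N K : nat) : (2 < m)%N ->
  (7 * 3 ^ m <= 9 * N.*2.+1)%N -> (K + 2 * m = N)%N -> ~ qhamming_bound 3 N K 5.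
Proof.
move=> m_gt2 NT KN; rewrite /qhamming_bound.
have -> : (N - K = m * 2)%N by rewrite -KN addKn mulnC.
have T27 : (27 <= 3 ^ m)%N by rewrite (leq_pexp2l (m := 3) (n1 := 3)).
have C2 : ('C(N, 2) * 2 = N * N.-1)%N by have := bin_ffact N 2; rewrite ffactnS ffactn1.
(* With M = 2N + 1 the sum 1 + 8N + 64 C(N, 2) equals 8M^2 - 28M + 21. It exceeds T^2 for T = 3^m >=
   27, since M >= 7T/9 and 8 * 49/81 > 1. *)
rewrite (_ : (\sum_(j < ((5 - 1) %/ 2).+1) _ = 1 + N * 8 + 'C(N, 2) * 64)%N); last first.
  by rewrite !big_ord_recl big_ord0 /= addn0 addnA bin0 bin1.
rewrite expnM; move: (3 ^ m)%N T27 NT => T T27 NT.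
by have := C2; nia.
Qed.

Lemma exp3_int a : (3 ^+ a : int) = (3 ^ a)%N%:Z.
Proof. by elim: a => // a IH; rewrite exprS IH expnS PoszM. Qed.

Theorem theorem8 (eps0 : int) (n s : nat) :
  (eps0 = 1 \/ eps0 = -1) ->
  ((~~ odd (n + s) -> (s + 4 <= n)%N -> (6 <= n + s)%N ->
    forall N K : nat,
      (N *+ 2)%:Z = 3 ^+ (n - 1) + eps0 *+ 2 * 3 ^+ ((n + s)./2 - 1) - 1 ->
      (K + 2 * n = N + 2)%N ->
      (exists Q : {vspace qstate 3 N}, is_pure_qcode 3 N K 3 Q) /\
      qhamming_at_least_almost_optimal 3 N K 3)
  /\
  (odd (n + s) -> (s + 3 <= n)%N -> (5 <= n + s)%N ->
    forall N K : nat,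
      (N * 2 = 3 ^ (n - 1) - 1)%N ->
      (K + 2 * n = N + 2)%N ->
      (exists Q : {vspace qstate 3 N}, is_pure_qcode 3 N K 3 Q) /\
      qhamming_at_least_almost_optimal 3 N K 3)).
Proof.
move=> eps; split=> [_ sn ns|nsodd sn ns] N K NE KE.
  have [m nE] : exists m, n = m.+1 by exists n.-1; lia.
  (* Here k = (n + s)/2 is [j.+3]: k >= 3 gives the flat the two free directions [i1] and [i2], and
     k < m leaves room for [ik]. *)
  have [j kE] : exists j, (n + s)./2 = j.+3 by exists ((n + s)./2 - 3)%N; lia.
  have j_lt : (j.+3 < m)%N by lia.
  rewrite kE nE !subn1 /= in NE.
  have KN : (K + 2 * m = N)%N by lia.
  (* Hence 2N + 1 is at least 7/9 of 3^m even after the flat is removed, the ratio in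
     [hamming_5_violated]. *)
  have jT : (9 * 3 ^ j.+2 <= 3 ^ m)%N by rewrite -(expnD 3 2) leq_exp2l //; lia.
  pose i0 : 'I_m := Ordinal (ltn_trans (isT : (0 < j.+3)%N) j_lt).
  pose i1 : 'I_m := Ordinal (ltn_trans (isT : (1 < j.+3)%N) j_lt).
  pose i2 : 'I_m := Ordinal (ltn_trans (isT : (2 < j.+3)%N) j_lt).
  (* Coordinates [ik], of index k, and [l], the last one, both vanish on the flat. *)
  pose ik : 'I_m := Ordinal j_lt.
  have l_lt : (m.-1 < m)%N by lia.
  pose l : 'I_m := Ordinal l_lt.
  have l_gt1 : (1 < l)%N by rewrite /=; lia.
  pose J := leading_one m; pose A := affine_flat i0 j.+3.
  have A_card : #|A| = (3 ^ j.+2)%N by apply: card_affine_flat => //; lia.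
  have A_sum a b c d : \sum_(x in A) (zdot a x + c) * (zdot b x + d) = 0.
    by apply: (@sum_quadratic _ _ i1 i2) => //; apply: affine_flat_shift.
  have J_sum a b : \sum_(x in J) zdot a x * zdot b x = 0 by apply: (@sum_leading_one _ i0 i1).
  have J_card := card_leading_one m.
  have AJ : A \subset J.
    by apply/subsetP => x; rewrite inE => /andP[/eqP x1 _]; rewrite (leading_oneP (i := i0)) ?x1.
  rewrite !exp3_int !mulr2n -[(N + N)%R]/(N + N)%N in NE.
  rewrite -/J in J_card.
  (* The sign 1 adjoins the translated flat to [J]; the sign -1 removes the flat from [J]. *)
  have [NJ | NJ] : (N = #|J| + #|A| \/ N = #|J :\: A| + #|set0 : {set basis_lbl 3 m}|)%N.
    case: eps NE => -> NE; [left|right].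
      by rewrite A_card; lia.
    by rewrite cardsD (setIidPr AJ) cards0 addn0 A_card; lia.
  (* Almost optimality is certified by excluding distance 5 = 3 + 2. *)
  - split; last by right; apply: (hamming_5_violated (m := m)) => //; lia.
    rewrite NJ in KN *; apply: (config_code (i0 := i0) (i1 := i1) (ik := ik) (l := l)) KN => //.
    by move=> x; rewrite inE => /andP[/eqP-> /forallP/(_ ik)]; rewrite /= leqnn => /eqP.
  - split; last first.
      right; apply: (hamming_5_violated (m := m)) => //; first by lia.
      have := subset_leq_card AJ; rewrite cardsD (setIidPr AJ) cards0 A_card in NJ *; lia.
    rewrite NJ in KN *; apply: (config_code (i0 := i0) (i1 := i1) (ik := ik) (l := l)
      (D := J :\: A) (B := set0)) KN => //.
    + exact: subsetDl.
    + move=> x xJ x0l; rewrite in_setD xJ andbT inE.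
      apply: contraL x0l => /andP[/eqP-> /forallP/(_ l)].
      by rewrite /= (_ : j.+2 < m.-1)%N ?negbK //; lia.
    + by move=> x; rewrite inE.
    + move=> a b; have := J_sum a b; rewrite (big_setID A) /= (setIidPr AJ).
      have -> : \sum_(x in A) zdot a x * zdot b x = 0.
        by rewrite -[RHS](A_sum a b 0 0); apply: eq_bigr => x _; rewrite !addr0.
      by rewrite add0r.
    by move=> *; rewrite big_set0.
have [m nE] : exists m, n = m.+1 by exists n.-1; lia.
(* From n + s >= 5 and s + 3 <= n follows 2n >= 8. *)
have m_gt2 : (2 < m)%N by lia.
have KN : (K + 2 * m = N)%N by lia.
rewrite nE !subn1 /= in NE.
have J_card := card_leading_one m.
have NJ : N = (#|leading_one m| + #|set0 : {set basis_lbl 3 m}|)%N by rewrite cards0; lia.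
have l_lt : (m.-1 < m)%N by lia.
pose i0 : 'I_m := Ordinal (ltn_trans (isT : (0 < 2)%N) m_gt2).
pose i1 : 'I_m := Ordinal (ltn_trans (isT : (1 < 2)%N) m_gt2).
pose l : 'I_m := Ordinal l_lt.
have l_gt1 : (1 < l)%N by rewrite /=; lia.
split; last by right; apply: (hamming_5_violated (m := m)) => //; rewrite cards0 in NJ; lia.
(* With [B] empty all points are real; [i1] is a default for the direction [ik], which has to differ
   from [i0]. *)
rewrite NJ in KN *; apply: (config_code (i0 := i0) (i1 := i1) (ik := i1) (l := l)
  (D := leading_one m) (B := set0)) KN => //.
- by move=> x; rewrite inE.
- by move=> a b; apply: (@sum_leading_one _ i0 i1).
by move=> *; rewrite big_set0.
Qed.
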